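(* Let $G=(V,E)$ be a finite directed graph in which every vertex has an incoming edge and an outgoing edge. For every $n=0,1,2,\dots$ we have $t_n^G[e]=d_n^G[e]$ for all $e\in E$ and $t_n^G(u)=d_n^G(u)$ for all $u\in V$, so that $$t_n^G=d_n^G .$$
   Context: For $e\in E$ let $s(e),t(e)$ be its source and terminal vertex. Loops and multiple edges are allowed. $G^*$ is the transposed graph: same vertex set, and the edge $e^*$ is $e$ reversed, so $s(e^* )=t(e)$, $t(e^* )=s(e)$. **$G$-rooted trees.** A rooted tree is a plane tree with a distinguished vertex, the root (plane: the children of each vertex are linearly ordered). A $G$-rooted tree with $n$ edges is a rooted tree with $n$ edges, all oriented away from the root, such that (1) each edge together with its two endpoints is labeled by an edge of $G^*$ together with its endpoints (that is, vertices are labeled by elements of $V$, edges by edges $e^*$ of $G^*$, and an edge labeled $e^*$ goes from a vertex labeled $s(e^* )$ to a vertex labeled $t(e^* )$), and so (2) an edge labeled $e^*$ follows an edge labeled $f^*$ in the tree only if $e^*$ follows $f^*$ in $G^*$. Let $T_n^G$ be the set of $G$-rooted trees with $n$ edges, $T_n^G(u)$ the subset of those whose root is labeled $u$, and $T_n^G[e]$ the subset of those whose root is labeled $s(e)$. For $n\ge1$: $t_n^G=|T_n^G|$, $t_n^G(u)=|T_n^G(u)|$, $t_n^G[e]=|T_n^G[e]|$; and $t_0^G=|V|$, $t_0^G(u)=t_0^G[e]=1$. **$G$-Dyck paths.** A Dyck path of length $2n$ is a sequence $\gamma=(\gamma_1,\dots,\gamma_{2n})$ of vectors $(1,1)$ and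 $(1,-1)$ such that the broken line starting at the origin stays in $y\ge0$ and ends on the $x$-axis. If $\gamma_i=(1,1)$, its partner is the unique $\gamma_{i+k}=(1,-1)$ such that $(\gamma_{i+1},\dots,\gamma_{i+k-1})$ is a (possibly empty) Dyck path. A $G$-Dyck path of length $2n$ is a Dyck path of length $2n$ whose vectors are labeled so that: (1) vectors $(1,1)$ are labeled by $e^*$, $e\in E$; (2) vectors $(1,-1)$ are labeled by $e\in E$; (3) a vector $(1,1)$ labeled $e^*$ may immediately follow a vector $(1,1)$ labeled $f^*$ only if $t(f^* )=s(e^* )$; (4) a vector $(1,1)$ labeled $e^*$ may immediately follow a vector $(1,-1)$ labeled $f$ only if $t(f)=s(e^* )$; (5) a vector $(1,-1)$ labeled $e$ may immediately follow a vector $(1,1)$ labeled $f^*$ only if $e=f$; (6) the partner of a vector $(1,1)$ labeled $e^*$ is labeled $e$. Let $D_n^G$ be the set of $G$-Dyck paths of length $2n$, $r(\gamma)\in E$ the label of the last vector of $\gamma$, $D_n^G[e]=\{\gamma\in D_n^G\mid (e^*,\gamma_1,\dots,\gamma_{2n},e)\in D_{n+1}^G\}$, $D_n^G(u)=\{\gamma\in D_n^G\mid t(r(\gamma))=u\}$. For $n\ge1$: $d_n^G=|D_n^G|$, $d_n^G[e]=|D_n^G[e]|$, $d_n^G(u)=|D_n^G(u)|$; and $d_0^G=|V|$, $d_0^G[e]=d_0^G(u)=1$. *)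

(* Defs.v *)
From HB Require Import structures.
From mathcomp Require Import all_boot.

Set Implicit Arguments.
Unset Strict Implicit.
Unset Printing Implicit Defensive.

(* Loops and multiple edges are allowed: [edge] is an arbitrary finite type. *)
Record digraph : Type := Digraph {
  vert : finType;
  edge : finType;
  src : edge -> vert;
  tgt : edge -> vert
}.

Definition transpose (G : digraph) : digraph := Digraph (@tgt G) (@src G).

(* The edge e^* of the transposed graph attached to the edge e. *)
Definition star (G : digraph) (e : edge G) : edge (transpose G) := e.

(* Rooted plane trees with labels on vertices and edges: a node carries its
   vertex label and the linearly ordered list of its children, each paired
   with the label of the edge leading to it. Leibniz equality is thus
   isomorphism of labeled plane rooted trees. *)
Inductive ltree (V E : Type) : Type :=
  LNode of V & seq (E * ltree V E).

Section LabeledTrees.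
Variables (V E : Type).

Definition root_label (T : ltree V E) : V := let: LNode v _ := T in v.

Fixpoint nedges (T : ltree V E) : nat :=
  let: LNode _ ts := T in sumn (map (fun et => (nedges et.2).+1) ts).

Fixpoint ltree_encode (T : ltree V E) : GenTree.tree (V + E) :=
  let: LNode v ts := T in
  GenTree.Node 0 (GenTree.Leaf (inl v) ::
    map (fun et => GenTree.Node 1
                     [:: GenTree.Leaf (inr et.1); ltree_encode et.2]) ts).

Fixpoint ltree_decode (c : GenTree.tree (V + E)) : option (ltree V E) :=
  match c with
  | GenTree.Node 0 (GenTree.Leaf (inl v) :: cs) =>
      Some (LNode v (pmap (fun c' =>
        match c' with
        | GenTree.Node 1 [:: GenTree.Leaf (inr e); c1] =>
            omap (pair e) (ltree_decode c1)
        | _ => None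
        end) cs))
  | _ => None
  end.

Lemma ltree_ind_forest (P : ltree V E -> Prop) (Q : seq (E * ltree V E) -> Prop) :
  (forall v ts, Q ts -> P (LNode v ts)) -> Q [::] ->
  (forall e T ts, P T -> Q ts -> Q ((e, T) :: ts)) -> forall T, P T.
Proof.
move=> HN H0 HC; fix rec 1 => -[v ts]; apply: HN.
by elim: ts => [//|[e T] ts IH]; apply: HC; [exact: rec|].
Qed.

Lemma ltree_encodeK : pcancel ltree_encode ltree_decode.
Proof.
move=> T; apply: (@ltree_ind_forest (fun T => ltree_decode (ltree_encode T) = Some T)
  (fun ts => pmap (fun c' =>
        match c' with
        | GenTree.Node 1 [:: GenTree.Leaf (inr e); c1] =>
            omap (pair e) (ltree_decode c1)
        | _ => None
        end) (map (fun et => GenTree.Node 1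
          [:: GenTree.Leaf (inr et.1); ltree_encode et.2]) ts) = ts)) T.
- by move=> v ts /= ->.
- by [].
- by move=> e T ts /= -> /= ->.
Qed.

End LabeledTrees.

HB.instance Definition _ (V E : eqType) :=
  Equality.copy (ltree V E) (pcan_type (@ltree_encodeK V E)).
HB.instance Definition _ (V E : choiceType) :=
  Choice.copy (ltree V E) (pcan_type (@ltree_encodeK V E)).
HB.instance Definition _ (V E : countType) :=
  PCanIsCountable (@ltree_encodeK V E).

(* Each tree edge, oriented away from the root, is labeled together with its
   endpoints by an edge of H and its endpoints. *)
Fixpoint labeled_by (H : digraph) (T : ltree (vert H) (edge H)) : bool :=
  let: LNode v ts := T in
  all (fun et => [&& src et.1 == v, tgt et.1 == root_label et.2
                   & labeled_by et.2]) ts.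

Definition rooted_tree_pred (G : digraph) (n : nat) :
    pred (ltree (vert (transpose G)) (edge (transpose G))) :=
  fun T => (nedges T == n) && labeled_by T.

(* The set T_n^G, as a type; the instances below make it a finite type. *)
Record rooted_tree (G : digraph) (n : nat) : Type := RootedTree {
  tree_of :> ltree (vert (transpose G)) (edge (transpose G));
  _ : rooted_tree_pred n tree_of
}.

HB.instance Definition _ G n := [isSub for @tree_of G n].
HB.instance Definition _ G n := [Countable of rooted_tree G n by <:].

Section FinitelyManyTrees.
Variables (V E : finType).

(* Contains all forests with at most n edges, and possibly larger ones. *)
Fixpoint forests (n : nat) : seq (seq (E * ltree V E)) :=
  if n is n'.+1 then
    [::] :: [seq (p.1, LNode p.2 x.1) :: x.2
             | p <- enum {: E * V},
               x <- [seq (f, g) | f <- forests n', g <- forests n']]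
  else [:: [::]].

Definition trees (n : nat) : seq (ltree V E) :=
  [seq LNode v f | v <- enum V, f <- forests n].

Lemma mem_forests n (ts : seq (E * ltree V E)) :
  sumn (map (fun et => (nedges et.2).+1) ts) <= n -> ts \in forests n.
Proof.
elim: n ts => [|n IH] [|[e [v f]] g] //=; rewrite addSn ltnS => le_n.
rewrite inE /=; apply/allpairsP; exists ((e, v), (f, g)) => /=.
rewrite mem_enum; split=> //; apply/allpairsP; exists (f, g) => /=.
by split=> //; apply: IH; apply: leq_trans le_n; [exact: leq_addr|exact: leq_addl].
Qed.

Lemma mem_trees n (T : ltree V E) : nedges T <= n -> T \in trees n.
Proof.
case: T => v f le_n; apply/allpairsP; exists (v, f) => /=.
by rewrite mem_enum; split=> //; exact: mem_forests.
Qed.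

End FinitelyManyTrees.

Definition rooted_tree_enum (G : digraph) (n : nat) : seq (rooted_tree G n) :=
  undup (pmap insub (trees _ _ n)).

Lemma rooted_tree_enumP G n : Finite.axiom (rooted_tree_enum G n).
Proof.
apply: Finite.uniq_enumP; first exact: undup_uniq.
move=> T; rewrite mem_undup mem_pmap_sub; apply: mem_trees.
by have /andP[/eqP-> _] := valP T.
Qed.

HB.instance Definition _ G n :=
  isFinite.Build (rooted_tree G n) (@rooted_tree_enumP G n).

(* [inl e] is a vector (1,1) labeled by the edge e of G^*,
   [inr e] is a vector (1,-1) labeled by the edge e of G. *)
Notation step G := (edge (transpose G) + edge G)%type.

Definition up (G : digraph) (x : step G) : bool :=
  if x is inl _ then true else false.

(* Unlabeled paths: [true] is (1,1), [false] is (1,-1). *)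
Definition dyck (w : seq bool) : bool :=
  [forall k : 'I_(size w).+1,
     count negb (take k w) <= count id (take k w)]
  && (count negb w == count id w).

(* The j-th vector of w is the partner of the i-th one. *)
Definition partner (w : seq bool) (i j : nat) : bool :=
  [&& i < j < size w, nth false w i, ~~ nth true w j
    & dyck (take (j - i.+1) (drop i.+1 w))].

(* [may_follow x y]: y may immediately follow x. *)
Definition may_follow (G : digraph) : rel (step G) := fun x y =>
  match x, y with
  | inl f', inl e' => tgt f' == src e'
  | inr f, inl e' => tgt f == src e'
  | inl f', inr e => star e == f'
  | inr _, inr _ => true
  end.

Definition partners_match (G : digraph) (p : seq (step G)) : bool :=
  [forall i : 'I_(size p), forall j : 'I_(size p), forall e : edge G,
     partner (map (@up G) p) i j ==>
     (tnth (in_tuple p) i == inl (star e)) ==>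
     (tnth (in_tuple p) j == inr e)].

Definition gdyck (G : digraph) (p : seq (step G)) : bool :=
  [&& dyck (map (@up G) p), sorted (@may_follow G) p & partners_match p].

Section Counting.
Variable G : digraph.

Definition tcount (n : nat) : nat :=
  if n is 0 then #|vert G| else #|{: rooted_tree G n}|.

Definition tcount_vert (n : nat) (u : vert G) : nat :=
  if n is 0 then 1 else #|[set T : rooted_tree G n | root_label T == u]|.

Definition tcount_edge (n : nat) (e : edge G) : nat :=
  if n is 0 then 1 else #|[set T : rooted_tree G n | root_label T == src e]|.

(* D_n^G *)
Definition dyck_paths (n : nat) : {set (n.*2).-tuple (step G)} :=
  [set p : (n.*2).-tuple (step G) | gdyck p].

(* r(p), the label of the last vector of p (none if p is empty). For
   p in D_n^G with n > 0 the last vector is a (1,-1); the other case only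
   makes the function total. *)
Definition last_label (p : seq (step G)) : option (edge G) :=
  if rev p is inr e :: _ then Some e else None.

(* D_n^G[e]; note that n.+1.*2 is convertible to n.*2.+2. *)
Definition dyck_paths_edge (n : nat) (e : edge G) :
    {set (n.*2).-tuple (step G)} :=
  [set p in dyck_paths n |
     [tuple of inl (star e) :: rcons p (inr e)] \in dyck_paths n.+1].

(* D_n^G(u) *)
Definition dyck_paths_vert (n : nat) (u : vert G) :
    {set (n.*2).-tuple (step G)} :=
  [set p in dyck_paths n | omap (@tgt G) (last_label p) == Some u].

(* The values for n = 0 are conventions: the empty path is counted once for
   each vertex. *)
Definition dcount (n : nat) : nat :=
  if n is 0 then #|vert G| else #|dyck_paths n|.

Definition dcount_edge (n : nat) (e : edge G) : nat :=
  if n is 0 then 1 else #|dyck_paths_edge n e|.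

Definition dcount_vert (n : nat) (u : vert G) : nat :=
  if n is 0 then 1 else #|dyck_paths_vert n u|.

End Counting.

(* Main.v *)
(** Walking around a tree, record [inl e] when an edge labeled [e^*] is first
    traversed and [inr e] when it is traversed back. Splitting a nonempty Dyck
    path at its first return to the axis as [inl e :: p ++ inr e :: q] matches
    splitting a nonempty forest into its first tree and the remaining ones, and
    the labeling conditions correspond: [p] starts at [src e], the label of the
    child, and [q] at [tgt e], the label of the parent. Vertex labels are
    recovered from edge labels as soon as the root label is known, and the
    latter is the target of the last edge of the path. *)
Require Import Defs.
From mathcomp Require Import all_boot.
From mathcomp Require Import zify.

Set Implicit Arguments.
Unset Strict Implicit.
Unset Printing Implicit Defensive.

Lemma cat_eq_split (T : Type) (a b c d : seq T) : a ++ b = c ++ d ->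
  (exists r, a = c ++ r /\ d = r ++ b) \/ (exists r, c = a ++ r /\ b = r ++ d).
Proof.
elim: a c => [|x a IH] [|y c] /=; first by move=> ->; left; exists [::].
- by move=> ->; right; exists (y :: c).
- by move=> <-; left; exists (x :: a).
case=> <- /IH[[r [-> ->]]|[r [-> ->]]]; first by left; exists r.
by right; exists r.
Qed.

(** * Unlabeled Dyck words and their first-return decomposition *)

Section DyckWords.
Implicit Types w a b : seq bool.

Lemma dyckP w :
  reflect ((forall a b, w = a ++ b -> count negb a <= count id a)
           /\ count negb w = count id w) (dyck w).
Proof.
apply: (iffP andP) => -[Hpre Heq]; split; [|exact/eqP| |exact/eqP].
- move=> a b Dw.
  have lt_a : size a < (size w).+1 by rewrite Dw size_cat ltnS leq_addr.
  by have := forallP Hpre (Ordinal lt_a); rewrite /= Dw take_size_cat.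
- by apply/forallP => k; apply: (Hpre _ (drop k w)); rewrite cat_take_drop.
Qed.

Lemma dyck_nil : dyck [::].
Proof. by apply/dyckP; split=> // -[|? ?] // b. Qed.

Lemma dyck_prefix a b : dyck (a ++ b) -> count negb a <= count id a.
Proof. by case/dyckP => /(_ a b erefl). Qed.

Lemma dyck_suffix a b : dyck (a ++ b) -> count id b <= count negb b.
Proof.
by move=> D; have := dyck_prefix D; have /dyckP[_] := D; rewrite !count_cat; lia.
Qed.

Lemma dyck_cat w1 w2 : dyck w1 -> dyck (w1 ++ w2) = dyck w2.
Proof.
move=> /dyckP[H1 E1]; apply/dyckP/dyckP => -[H E].
- split; last by move: E; rewrite !count_cat; lia.
  move=> a b Dw2; have := H (w1 ++ a) b; rewrite -catA -Dw2 !count_cat.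
  by move=> /(_ erefl); lia.
- split; last by rewrite !count_cat; lia.
  move=> a b /cat_eq_split[[r [Dw1 _]]|[r [-> Dw2]]]; first exact: H1 Dw1.
  by have := H r b Dw2; rewrite !count_cat; lia.
Qed.

Lemma dyck_wrap w : dyck w -> dyck (true :: rcons w false).
Proof.
move=> /dyckP[H E]; apply/dyckP; split; last first.
  by rewrite -cats1 /= !count_cat /=; lia.
move=> [|x a] b //= [<-]; rewrite -cats1.
case/cat_eq_split=> [[r [Dw _]]|[r [-> Dr]]] /=.
  by have := H _ _ Dw; lia.
(* Here [r] is a prefix of the single closing descent, which the initial ascent compensates. *)
by have := congr1 (count negb) Dr; rewrite !count_cat /=; lia.
Qed.

Lemma dyck_first_return w1 w2 :
  dyck w1 -> dyck (true :: w1 ++ false :: w2) = dyck w2.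
Proof. by move/dyck_wrap=> D; rewrite -(dyck_cat w2 D) /= cat_rcons. Qed.

(** Strong induction on length. If [p] begins with an ascent, the induction hypothesis is used
    twice: first to find the descent closing this ascent, then on what follows it, which still has
    an excess of descents. *)
Lemma first_descent (T : Type) (a : T -> bool) (p : seq T) :
  count a p < count (predC a) p ->
  exists p1 x p2, [/\ p = p1 ++ x :: p2, ~~ a x & dyck (map a p1)].
Proof.
have [n] := ubnP (size p); elim: n p => // n IH [|x p] //= /ltnSE-le_p.
case: (boolP (a x)) => ax lt_p; last by exists [::], x, p; rewrite dyck_nil.
have [||p1 [y [p2 [Dp /negbTE ay D1]]]] := IH p; [lia|move: lt_p => /=; lia|].
move: le_p lt_p; rewrite Dp size_cat !count_cat /= ay => le_p lt_p.
have /dyckP[_] := D1; rewrite !count_map => /= E1.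
have E1' : count a p1 = count (predC a) p1.
  by rewrite -[RHS](eq_count (a1 := preim a negb)).
have [||p3 [z [p4 [-> az D3]]]] := IH p2; [lia|move: lt_p => /=; lia|].
exists (x :: p1 ++ y :: p3), z, p4; split=> //; first by rewrite /= -catA.
by rewrite /= map_cat /= ax ay dyck_first_return.
Qed.

(** If one of the two Dyck prefixes were longer, it would begin with the other one followed by a
    descent, hence fall below the axis. *)
Lemma first_return_inj (T : Type) (a : T -> bool) (p1 p2 q1 q2 : seq T) x y :
  ~~ a x -> ~~ a y -> dyck (map a p1) -> dyck (map a q1) ->
  p1 ++ x :: p2 = q1 ++ y :: q2 -> p1 = q1 /\ p2 = q2.
Proof.
have no_descent s z r : ~~ a z -> dyck (map a s) -> ~ dyck (map a (s ++ z :: r)).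
  move=> /negbTE az Ds; rewrite map_cat (dyck_cat _ Ds) /= az -cat1s.
  by move/dyck_prefix.
move=> ax ay D1 D2 /cat_eq_split[[[|z r]]|[[|z r]]].
- by rewrite cats0 => -[-> [_ ->]].
- by case=> Dp [Dz _]; move: D1; rewrite Dp -Dz => /(no_descent _ _ _ ay D2).
- by rewrite cats0 => -[-> [_ ->]].
- by case=> Dq [Dz _]; move: D2; rewrite Dq -Dz => /(no_descent _ _ _ ax D1).
Qed.

End DyckWords.

(** * Labeled paths: partner and adjacency conditions under first return *)

Section GDyck.
Variable G : digraph.
Implicit Types (p q : seq (step G)) (e : edge G).

Local Notation ups p := (map (@up G) p).

(** Trades positions for factorizations of [p], so that concatenations can be analysed with
    [cat_eq_split]. *)
Lemma partners_matchP p :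
  reflect (forall a e b y c, p = a ++ inl e :: b ++ y :: c -> ~~ up y ->
             dyck (ups b) -> y = inr e)
          (partners_match p).
Proof.
apply: (iffP idP) => [pm a e b y c Dp yD bD|H].
  have nth_mid (T : Type) (z x : T) s r : nth z (s ++ x :: r) (size s) = x.
    by rewrite nth_cat ltnn subnn.
  set j := size (a ++ inl e :: b).
  have Dj : j = size a + (size b).+1 by rewrite /j size_cat.
  have Dp' : p = (a ++ inl e :: b) ++ y :: c by rewrite Dp -catA.
  have ltj : j < size p by rewrite Dp' size_cat /= -/j; lia.
  have lti : size a < size p by lia.
  move: pm => /forallP/(_ (Ordinal lti))/forallP/(_ (Ordinal ltj))/forallP/(_ e).
  rewrite !(tnth_nth y) /= {2}Dp {2}Dp' !nth_mid eqxx => /implyP H.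
  have Db : drop (size a).+1 (ups p) = ups b ++ ups (y :: c).
    rewrite Dp -cat_rcons !map_cat -(size_rcons a (inl e)).
    by rewrite -(size_map (@up G)) drop_size_cat.
  apply/eqP; apply: H; rewrite /partner size_map ltj Db.
  rewrite (nth_map y) // {1}Dp nth_mid (nth_map y) // {1}Dp' nth_mid yD Dj /=.
  rewrite addnS subSS addKn -(size_map (@up G) b) take_size_cat // bD andbT.
  by lia.
apply/forallP => i; apply/forallP => j; apply/forallP => e.
apply/implyP; rewrite /partner => /and4P[/andP[ltij ltj] _ yD bD].
apply/implyP => /eqP xE; apply/eqP.
rewrite size_map in ltj.
set y := tnth _ j.
have Ey : y = nth (inl e) p j by rewrite /y (tnth_nth (inl e)).
apply: (H (take i p) e (take (j - i.+1) (drop i.+1 p)) y (drop j.+1 p)).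
- rewrite -{1}(cat_take_drop i p) (drop_nth (inl e)) //.
  rewrite -(tnth_nth _ (in_tuple p)) xE; congr (_ ++ _ :: _).
  rewrite -{1}(cat_take_drop (j - i.+1) (drop i.+1 p)) drop_drop subnK //.
  by rewrite -/y Ey -drop_nth.
- by rewrite Ey; move: yD; rewrite (nth_map (inl e)).
- by rewrite map_take map_drop.
Qed.

Lemma partners_match_sub a p b :
  partners_match (a ++ p ++ b) -> partners_match p.
Proof.
move=> /partners_matchP H; apply/partners_matchP => a' e b' y c Dp.
by apply: (H (a ++ a') e b' y (c ++ b)); rewrite Dp -!catA /= -!catA.
Qed.

(** The first word forces more descents than ascents in [b], the second forbids it. So no ascent
    inside a Dyck factor has its partner beyond that factor. *)
Lemma dyck_straddle a e (b c : seq (step G)) :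
  dyck (ups (a ++ inl e :: b)) -> dyck (ups (b ++ c)) -> False.
Proof.
by rewrite !map_cat /= => /dyck_suffix /= H /dyck_prefix; move: H; lia.
Qed.

Lemma partners_match_cat p q : dyck (ups p) ->
  partners_match p -> partners_match q -> partners_match (p ++ q).
Proof.
move=> Dp /partners_matchP Hp /partners_matchP Hq.
apply/partners_matchP => a e b y c E yD bD; move: E.
case/cat_eq_split=> [[[|x r] [Ep]]|[r [_ Eq]]]; last exact: Hq Eq yD bD.
  by move=> /esym Eq; apply: (Hq [::]) Eq yD bD.
(* The ascent lies in [p]. Its partner is inside [q], at the start of [q], or in [p]; the first two
   cases straddle the boundary. *)
case=> Ex; subst x => /cat_eq_split[[s [Eb _]]|[[|z s] [Er]]].
- by subst; case: (dyck_straddle Dp bD).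
- rewrite cats0 in Er; subst; case: (@dyck_straddle a e b [::]) => //.
  by rewrite cats0.
- by case=> Ez; subst => _; apply: (Hp a e b z s).
Qed.

Lemma partners_match_wrap p e : dyck (ups p) ->
  partners_match p -> partners_match (inl (star e) :: rcons p (inr e)).
Proof.
move=> Dp /partners_matchP Hp; apply/partners_matchP => a f b y c E yD bD.
have yE : up y = false by apply/negbTE.
(* Four cases: the ascent is the added one or lies in [p], and the descent is the added one or lies
   in [p]. The mixed cases contradict [Dp]. *)
case: a E => [|x a] /= [Ex]; case: (lastP c) => [|c' z].
- by rewrite cats1 -Ex => /rcons_inj[].
- rewrite -rcons_cons -rcons_cat => /rcons_inj[Ep _]; move: Dp.
  by rewrite Ep map_cat dyck_cat //= yE -cat1s => /dyck_prefix.
- rewrite cats1 -rcons_cons -rcons_cat => /rcons_inj[Ep _]; subst p.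
  by case: (@dyck_straddle a f b [::]); rewrite ?cats0.
- rewrite -!(rcons_cons, rcons_cat) => /rcons_inj[Ep _].
  exact: Hp Ep yD bD.
Qed.

(** The source of [star e] is [tgt e]. The empty path may start at any vertex. *)
Definition starts_at (u : vert G) p : bool :=
  if p is inl e :: _ then @tgt G e == u else true.

Lemma path_after (x : step G) p (u : vert G) :
    (forall e, may_follow x (inl (star e)) = (tgt e == u)) -> dyck (ups p) ->
  path (@may_follow G) x p = starts_at u p && sorted (@may_follow G) p.
Proof.
move=> xu; case: p => [|[e|e] p] //= Dp; first by rewrite xu.
by move: Dp; rewrite -cat1s => /dyck_prefix.
Qed.

(** As [p] is Dyck, [inr e] is the partner of the initial ascent and no other pair crosses the cut.
    The adjacency conditions at the starts of [p] and [q] become the [starts_at] conditions. *)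
Lemma gdyck_first_return e p q : dyck (ups p) ->
  gdyck (inl (star e) :: p ++ inr e :: q) =
    [&& gdyck p, starts_at (src e) p, gdyck q & starts_at (tgt e) q].
Proof.
move=> Dp; rewrite /gdyck /= map_cat /= dyck_first_return // Dp /=.
have [Dq|] := boolP (dyck (ups q)); last by rewrite /= !andbF.
have -> : partners_match (inl (star e) :: p ++ inr e :: q) =
          partners_match p && partners_match q.
  apply/idP/andP => [H|[Hp Hq]].
    split; first exact: (@partners_match_sub [:: inl (star e)] _ (inr e :: q)).
    apply: (@partners_match_sub (inl (star e) :: rcons p (inr e)) _ [::]).
    by rewrite cats0 /= cat_rcons.
  rewrite -cat_rcons -cat_cons; apply: partners_match_cat => //.
    by rewrite /= map_rcons dyck_wrap.
  exact: partners_match_wrap.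
rewrite cat_path /= (@path_after _ _ (src e)) //.
rewrite (@path_after _ q (tgt e)) //.
(* Automatic: either [p] is empty and the labels agree, or [p] ends with a descent, which any
   descent may follow. *)
have -> : may_follow (last (inl (star e)) p) (inr e).
  case: (lastP p) Dp => [|r [f|f]]; rewrite ?last_rcons //= ?eqxx //.
  by rewrite map_rcons -cats1 => /dyck_suffix.
case: (starts_at (src e) p); case: (starts_at (tgt e) q); rewrite ?andbF //=.
by rewrite andbT andbACA.
Qed.

End GDyck.

(** * The walk around a tree and its inverse *)

Section TreeWalk.
Variable G : digraph.
Local Notation tree := (ltree (vert (transpose G)) (edge (transpose G))).
Local Notation ups p := (map (@up G) p).
(* [transpose G] has the same types of vertices and edges as [G], so that [G]
   cannot be inferred reliably from the arguments. *)
Local Notation starts_at := (@starts_at G).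
Implicit Types (T : tree) (p q : seq (step G)) (e : edge G).

Fixpoint walk T : seq (step G) :=
  let: LNode _ ts := T in
  flatten [seq inl et.1 :: rcons (walk et.2) (inr et.1) | et <- ts].

Lemma walk_cons v e T ts :
  walk (LNode v ((e, T) :: ts)) =
  inl (star e) :: walk T ++ inr e :: walk (LNode v ts).
Proof. by rewrite /= cat_rcons. Qed.

Lemma labeled_by_cons v e T ts :
  @labeled_by (transpose G) (LNode v ((e, T) :: ts)) =
  [&& tgt e == v, src e == root_label T, labeled_by T
    & @labeled_by (transpose G) (LNode v ts)].
Proof. by rewrite /= -!andbA. Qed.

Lemma size_walk T : size (walk T) = (nedges T).*2.
Proof.
(* A forest is treated as a tree by placing it under a root with arbitrary label [v]. *)
apply: (@ltree_ind_forest _ _ (fun T => size (walk T) = (nedges T).*2)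
  (fun ts => forall v, size (walk (LNode v ts)) = (nedges (LNode v ts)).*2)).
- by move=> v ts; apply.
- by [].
- move=> e S ts IHS IHts v; rewrite walk_cons /= size_cat /= (IHts v) IHS /=.
  by rewrite doubleD; lia.
Qed.

Lemma walk_gdyck T :
  labeled_by T -> gdyck (walk T) && starts_at (root_label T) (walk T).
Proof.
apply: (@ltree_ind_forest _ _
  (fun T => labeled_by T -> gdyck (walk T) && starts_at (root_label T) (walk T))
  (fun ts => forall v, @labeled_by (transpose G) (LNode v ts) ->
     gdyck (walk (LNode v ts)) && starts_at v (walk (LNode v ts)))).
- by move=> v ts; apply.
- move=> v _; rewrite /gdyck dyck_nil /= andbT.
  by apply/partners_matchP => -[].
- move=> e S ts IHS IHts v; rewrite labeled_by_cons walk_cons.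
  case/and4P=> /eqP Dv /eqP De /IHS/andP[gS sS] /IHts/andP[gts sts].
  rewrite gdyck_first_return; last by case/and3P: gS.
  by rewrite De gS sS gts Dv sts /= Dv eqxx.
Qed.

Lemma gdyck_walk p u : gdyck p -> starts_at u p ->
  exists T, [/\ labeled_by T, root_label T = u & walk T = p].
Proof.
have [n] := ubnP (size p); elim: n p u => // n IH [|x p] u /ltnSE-le_p gp sp.
  by exists (LNode u [::]).
case: x le_p gp sp => e le_p gp; last first.
  by case/and3P: gp; rewrite /= -cat1s => /dyck_prefix.
move=> /= /eqP tgt_e.
(* Without its initial ascent the path has exactly one more descent than ascents. *)
have [|p1 [y [p2 [Dp yD D1]]]] := @first_descent _ (@up G) p.
  case/and3P: gp => /dyckP[_ Eud] _ _; rewrite /= !count_map in Eud.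
  have -> : count (predC (@up G)) p = (count (@up G) p).+1 by exact: Eud.
  by [].
have Dy : y = inr e.
  case/and3P: gp => _ _ /partners_matchP; rewrite Dp.
  by move=> /(_ [::] e p1 y p2 erefl yD D1).
subst p y; move: gp; rewrite gdyck_first_return // => /and4P[g1 s1 g2 s2].
move: le_p; rewrite /= size_cat /= addnS => /ltnW le_p.
have [|T1 [L1 R1 W1]] := IH p1 _ _ g1 s1.
  exact: leq_ltn_trans (leq_addr _ _) le_p.
have [|[v ts] [L2 R2 W2]] := IH p2 _ _ g2 s2.
  exact: leq_ltn_trans (leq_addl _ _) le_p.
rewrite /= in R2; exists (LNode v ((e, T1) :: ts)).
by rewrite walk_cons labeled_by_cons L1 L2 R1 W1 W2 R2 !eqxx.
Qed.

(** Equal root labels are assumed because a one-vertex tree has an empty walk whatever its label. In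
    the induction, the first subtrees both have root label [src e]. *)
Lemma walk_inj T1 T2 : labeled_by T1 -> labeled_by T2 ->
  root_label T1 = root_label T2 -> walk T1 = walk T2 -> T1 = T2.
Proof.
move: T1 T2; pose P T1 := forall T2, labeled_by T1 -> labeled_by T2 ->
  root_label T1 = root_label T2 -> walk T1 = walk T2 -> T1 = T2.
apply: (@ltree_ind_forest _ _ P (fun ts => forall v, P (LNode v ts))).
- by move=> v ts; apply.
- by move=> v [w [|[e T] ts]] //= _ _ ->.
- move=> e S ts IHS IHts v [w [|[f T] us]] //.
  rewrite !labeled_by_cons => /and4P[/eqP te /eqP se LS Lts].
  case/and4P=> [_ /eqP sf LT Lus] /= vw; subst w; rewrite -!/(walk _) !cat_rcons.
  case=> ef; subst f.
  have dyckw T' : labeled_by T' -> dyck (ups (walk T')).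
    by case/walk_gdyck/andP => /and3P[].
  case/(@first_return_inj _ (@up G) _ _ _ _ (inr e) (inr e)
         isT isT (dyckw _ LS) (dyckw _ LT)).
  move=> /(IHS T LS LT) -> //; last by rewrite -se -sf.
  by move=> /(IHts v (LNode v us) Lts Lus erefl) [->].
Qed.

Lemma last_label_cat p x q : last_label (p ++ x :: q) = last_label (x :: q).
Proof.
rewrite /last_label rev_cat; case E: (rev (x :: q)) => [|y r] //.
by have := congr1 size E; rewrite size_rev.
Qed.

(** The last step goes back along the edge to the last child of the root. *)
Lemma last_label_walk T : labeled_by T -> 0 < nedges T ->
  omap (@tgt G) (last_label (walk T)) = Some (root_label T).
Proof.
case: T => v ts; elim: ts => // -[e S] ts IH.
rewrite labeled_by_cons walk_cons => /and4P[/eqP Dv _ _ /IH{}IH] _.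
rewrite -cat_cons last_label_cat.
case: ts IH => [_|[f S'] ts /(_ isT) <-]; first by rewrite /= Dv.
by rewrite walk_cons -[inr e :: _]cat1s last_label_cat.
Qed.

(** * The bijection for a fixed positive number of edges, and its restrictions *)

Section FixedSize.
Variables (n : nat) (n_gt0 : 0 < n).

Lemma size_walk_tree (T : rooted_tree G n) : size (walk T) == n.*2.
Proof. by case: T => T /= /andP[/eqP nT _]; rewrite size_walk nT. Qed.

Definition walk_tuple (T : rooted_tree G n) : n.*2.-tuple (step G) :=
  Tuple (size_walk_tree T).

Lemma rooted_treeP (T : rooted_tree G n) : nedges T = n /\ labeled_by T.
Proof. by case: T => T /= /andP[/eqP]. Qed.

Lemma walk_tuple_last_label (T : rooted_tree G n) :
  omap (@tgt G) (last_label (walk_tuple T)) = Some (root_label T).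
Proof. by have [nT LT] := rooted_treeP T; rewrite last_label_walk ?nT. Qed.

Lemma walk_tuple_inj : injective walk_tuple.
Proof.
move=> T1 T2 eqT; apply: val_inj.
have [_ L1] := rooted_treeP T1; have [_ L2] := rooted_treeP T2.
apply: walk_inj => //; last exact: (congr1 val eqT).
(* The root label can be read off the walk, since [n] is positive. *)
by apply: Some_inj; rewrite -!walk_tuple_last_label eqT.
Qed.

Lemma walk_tuple_gdyck (T : rooted_tree G n) : gdyck (walk_tuple T).
Proof. by have [_ /walk_gdyck/andP[]] := rooted_treeP T. Qed.

Lemma walk_tuple_starts_at (T : rooted_tree G n) (u : vert G) :
  starts_at u (walk_tuple T) = (root_label T == u).
Proof.
have [nT /walk_gdyck/andP[gT]] := rooted_treeP T.
have: 0 < size (walk T) by rewrite size_walk nT double_gt0.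
rewrite /=; case: (walk T) gT => [|[e|e] p] //= gT _; first by move/eqP->.
by case/and3P: gT; rewrite /= -cat1s => /dyck_prefix.
Qed.

Lemma gdyck_walk_tuple (p : n.*2.-tuple (step G)) :
  gdyck p -> exists T : rooted_tree G n, p = walk_tuple T.
Proof.
move=> gp; have [u su] : exists u, starts_at u p.
  case: p gp => -[|[e|e] p] /= sz gp.
  - by move: sz; rewrite eq_sym double_eq0 eqn0Ngt n_gt0.
  - by exists (@tgt G e).
  - by case/and3P: gp; rewrite /= -cat1s => /dyck_prefix.
have [T [LT _ WT]] := gdyck_walk gp su.
have PT : rooted_tree_pred n T.
  apply/andP; split=> //; apply/eqP/double_inj.
  by rewrite -size_walk WT size_tuple.
by exists (RootedTree PT); apply: val_inj; rewrite /= WT.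
Qed.

Lemma dyck_pathsE : dyck_paths G n = walk_tuple @: setT.
Proof.
apply/setP => p; rewrite inE; apply/idP/imsetP.
  by move=> /gdyck_walk_tuple[T ->]; exists T.
by case=> T _ ->; exact: walk_tuple_gdyck.
Qed.

Lemma dyck_paths_vertE (u : vert G) :
  dyck_paths_vert n u =
  walk_tuple @: [set T : rooted_tree G n | root_label T == u].
Proof.
apply/setP => p; rewrite !inE; apply/andP/imsetP => [[gp]|[T]].
  have [T ->] := gdyck_walk_tuple gp; rewrite walk_tuple_last_label => /eqP[<-].
  by exists T; rewrite ?inE.
rewrite inE => /eqP <- ->; rewrite walk_tuple_last_label.
by split; first exact: walk_tuple_gdyck.
Qed.

Lemma dyck_paths_edgeE e :
  dyck_paths_edge n e =
  walk_tuple @: [set T : rooted_tree G n | root_label T == src e].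
Proof.
have gdyck0 : gdyck ([::] : seq (step G)).
  by rewrite /gdyck dyck_nil; apply/partners_matchP => -[].
(* Wrapping is the first-return decomposition with empty second part. *)
have wrapE p : gdyck p ->
    gdyck (inl (star e) :: rcons p (inr e)) = starts_at (src e) p.
  move=> gp; rewrite -cats1 gdyck_first_return ?gp ?gdyck0 /= ?andbT //.
  by case/and3P: gp.
apply/setP => p; rewrite !inE; apply/andP/imsetP => [[gp]|[T]].
  rewrite wrapE //; have [T ->] := gdyck_walk_tuple gp.
  by rewrite walk_tuple_starts_at => rT; exists T; rewrite ?inE.
rewrite inE => rT ->; have gT := walk_tuple_gdyck T.
by rewrite wrapE // walk_tuple_starts_at.
Qed.

End FixedSize.

End TreeWalk.

Theorem proposition5p1 (G : digraph)
    (incoming : forall v : vert G, exists e : edge G, tgt e = v)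
    (outgoing : forall v : vert G, exists e : edge G, src e = v)
    (n : nat) :
  (forall e : edge G, tcount_edge n e = dcount_edge n e)
  /\ (forall u : vert G, tcount_vert n u = dcount_vert n u)
  /\ tcount G n = dcount G n.
Proof.
(* For [n = 0] both sides are the same convention. *)
case: n => [|n] //; split; last split; [move=> e|move=> u|]; rewrite /=.
- by rewrite dyck_paths_edgeE // card_imset //; exact: walk_tuple_inj.
- by rewrite dyck_paths_vertE // card_imset //; exact: walk_tuple_inj.
- by rewrite dyck_pathsE // card_imset ?cardsT //; exact: walk_tuple_inj.
Qed.
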